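(* Let $n\ge 1$ and let $A\in\mathcal{H}_n$ be a rank-one matrix. Then $$\lambda_{\max}(F_A)\le\operatorname{per}(A).$$
   Context: $\mathcal{H}_n$ denotes the set of $n\times n$ positive semidefinite Hermitian (complex) matrices. The permanent of an $n\times n$ matrix $A=[a_{i,j}]$ is $\operatorname{per}(A)=\sum_{\sigma\in S_n}\prod_{i=1}^n a_{i,\sigma(i)}$ (it is a nonnegative real number when $A\in\mathcal{H}_n$). For $A=[a_{i,j}]\in\mathcal{H}_n$, $F_A=[f_{i,j}]$ is the $n\times n$ matrix with $f_{i,j}=a_{i,j}\operatorname{per}(A(i,j))$, where $A(i,j)$ is the $(n-1)\times(n-1)$ submatrix of $A$ obtained by deleting the $i$-th row and $j$-th column (the permanent of an empty matrix is $1$); $F_A$ is again a positive semidefinite Hermitian matrix, and $\lambda_{\max}(F_A)$ denotes its largest eigenvalue. *)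

(* Defs.v *)
From mathcomp Require Import all_boot all_order all_fingroup all_algebra.
From mathcomp Require Import spectral sesquilinear.
From mathcomp Require Import classical_sets reals.
From mathcomp Require Import complex.

Set Implicit Arguments.
Unset Strict Implicit.
Unset Printing Implicit Defensive.

Import Order.TTheory GRing.Theory Num.Theory.
Local Open Scope ring_scope.
Local Open Scope complex_scope.
Local Open Scope sesquilinear_scope.

Definition psdmx (C : numClosedFieldType) n (A : 'M[C]_n) : Prop :=
  A \is hermsymmx /\ forall x : 'cV[C]_n, 0 <= (x^t* *m A *m x) 0 0.

(* For n = 0 the sum has one term, an empty product, so the value is 1. *)
Definition per (K : comNzRingType) n (A : 'M[K]_n) : K :=
  \sum_(s : 'S_n) \prod_(i < n) A i (s i).

Definition Fmx (K : comNzRingType) n (A : 'M[K]_n) : 'M[K]_n :=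
  \matrix_(i, j) (A i j * per (row' i (col' j A))).

(* Only meaningful for a Hermitian M of positive size, where the supremum is
   attained: see lambda_maxP. *)
Definition lambda_max (R : realType) n (M : 'M[R[i]]_n) : R :=
  sup [set x : R | eigenvalue M x%:C]%classic.

Lemma per_tr (K : comNzRingType) n (A : 'M[K]_n) : per A^T = per A.
Proof.
rewrite /per [LHS](reindex_inj invg_inj) /=; apply: eq_bigr => s _.
rewrite [LHS](reindex_inj (@perm_inj _ s)) /=; apply: eq_bigr => i _.
by rewrite mxE permK.
Qed.

Lemma per_map (K L : comNzRingType) (f : {rmorphism K -> L}) n (A : 'M[K]_n) :
  per (map_mx f A) = f (per A).
Proof.
rewrite /per rmorph_sum; apply: eq_bigr => s _; rewrite rmorph_prod.
by apply: eq_bigr => i _; rewrite mxE.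
Qed.

Lemma Fmx_hermitian (C : numClosedFieldType) n (A : 'M[C]_n) :
  A \is hermsymmx -> Fmx A \is hermsymmx.
Proof.
move=> /is_hermitianmxP; rewrite expr0 scale1r => hA.
apply/is_hermitianmxP; rewrite expr0 scale1r.
apply/matrixP => i j; rewrite !mxE rmorphM /= -per_map -[in RHS]per_tr.
congr (_ * _).
  by rewrite {1}hA !mxE.
by congr per; apply/matrixP => k l; rewrite !mxE {1}hA !mxE.
Qed.

Lemma hermitian_eigenvalue_real (C : numClosedFieldType) n (M : 'M[C]_n) a :
  M \is hermsymmx -> eigenvalue M a -> a \is Num.real.
Proof.
move=> /is_hermitianmxP; rewrite expr0 scale1r => hM /eigenvalueP[v vM v0].
have q0 : 0 < (v *m v^t*) 0 0 by rewrite -dotmxE; apply: dotmx_is_dotmx.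
have sE : (v *m M *m v^t*) 0 0 = a * (v *m v^t*) 0 0.
  by rewrite vM -scalemxAl mxE.
have : (v *m M *m v^t*) 0 0 \is Num.real.
  apply/CrealP.
  have -> : Num.conj ((v *m M *m v^t*) 0 0) = ((v *m M *m v^t*)^t*) 0 0 by rewrite !mxE.
  rewrite !trmx_mul !map_mxM trmxCK -hM mulmxA //.
rewrite sE => qr; rewrite -[a](mulfK (lt0r_neq0 q0)).
by rewrite realM ?realV // gtr0_real.
Qed.

Lemma lambda_maxP (R : realType) n (M : 'M[R[i]]_n) :
  (0 < n)%N -> M \is hermsymmx ->
  eigenvalue M (lambda_max M)%:C /\
  forall a : R[i], eigenvalue M a -> a <= (lambda_max M)%:C.
Proof.
move=> n0 hM; have [rs rsE] := closed_field_poly_normal (char_poly M).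
have lc : lead_coef (char_poly M) != 0.
  by rewrite lead_coef_eq0 monic_neq0 // char_poly_monic.
have eE a : eigenvalue M a = (a \in rs).
  by rewrite eigenvalue_root_char rsE rootZ // root_prod_XsubC.
have [a0 ea0] := eigenvalue_closed M n0.
have a0s : (index a0 rs < size rs)%N by rewrite index_mem -eE.
have [m _ mP] := @arg_maxP _ R _ (Ordinal a0s) xpredT
  (fun i => complex.Re rs`_i) isT.
set x := complex.Re rs`_m.
have em : eigenvalue M rs`_m by rewrite eE mem_nth.
have xE : x%:C = rs`_m.
  by rewrite RRe_real //; apply: hermitian_eigenvalue_real em.
have xub (y : R) : eigenvalue M y%:C -> y <= x.
  rewrite eE => yrs; have ys : (index y%:C rs < size rs)%N by rewrite index_mem.
  by have := mP (Ordinal ys) isT; rewrite /= nth_index.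
have ex : eigenvalue M x%:C by rewrite xE.
have -> : lambda_max M = x.
  apply/le_anti/andP; split.
    by apply: ge_sup; [exists x | move=> y; apply: xub].
  by apply: ub_le_sup => //; exists x => y; apply: xub.
split=> // a ea; have /complex_realP[k ak] := hermitian_eigenvalue_real hM ea.
by move: ea; rewrite ak lecR; apply: xub.
Qed.

(* Main.v *)
Require Import Defs.
From mathcomp Require Import all_boot all_order all_algebra.
From mathcomp Require Import reals complex.
From mathcomp Require Import perm.

(** A rank-one matrix factors as [A = u *m w], a column times a row, so every
    term of the permanent of [A], or of any of its submatrices, is the same
    product of entries of [u] and [w] ([per_rank1]): the permanent is a
    factorial times that product.  In the entry [A i j * per (A(i,j))] of
    [Fmx A], the factor [A i j = u_i w_j] restores exactly the two coordinates
    that deleting row [i] and column [j] removed.  Hence all the entries of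
    [Fmx A] equal the same constant, [(n-1)! * (prod u) * (prod w)], which is
    [per A / n] ([Fmx_rank1]).

    A constant matrix with entries [c] has no eigenvalues other than [0] and
    [n * c] ([eigenvalue_const_mx]), so the eigenvalues of [Fmx A] lie in
    [{0, per A}].  What remains is [0 <= per A]: [per A] is [n!] times the
    product of the diagonal entries [u_i w_i], which are nonnegative because
    [A] is positive semidefinite. *)

Import Order.TTheory GRing.Theory Num.Theory.
Local Open Scope ring_scope.
Local Open Scope complex_scope.

Lemma rank1_factor (F : fieldType) (m n : nat) (A : 'M[F]_(m, n)) :
  \rank A = 1%N -> exists (u : 'cV[F]_m) (w : 'rV[F]_n), A = u *m w.
Proof.
move=> rA; have := mulmx_base A; move: (col_base A) (row_base A).
by rewrite rA => u w <-; exists u, w.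
Qed.

Lemma mulmx_col_rowE (K : comNzRingType) (m n : nat)
    (u : 'cV[K]_m) (w : 'rV[K]_n) i j :
  (u *m w) i j = u i 0 * w 0 j.
Proof. by rewrite mxE big_ord1. Qed.

(** The families [f] and [g] are functions, rather than vectors, so that the
    lemma covers the submatrices of a rank-one matrix as well. *)
Lemma per_rank1 (K : comNzRingType) (n : nat) (A : 'M[K]_n) (f g : 'I_n -> K) :
  (forall i j, A i j = f i * g j) ->
  per A = (\prod_i f i * \prod_j g j) *+ n`!.
Proof.
move=> AE; rewrite /per -card_Sn -sumr_const; apply: eq_bigr => s _.
rewrite [\prod_j g j](reindex_inj (@perm_inj _ s)) -big_split.
by apply: eq_bigr => i _; apply: AE.
Qed.

Lemma Fmx_rank1 (K : comNzRingType) (n : nat) (u : 'cV[K]_n) (w : 'rV[K]_n) :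
  Fmx (u *m w) = const_mx ((\prod_i u i 0 * \prod_j w 0 j) *+ n.-1`!).
Proof.
apply/matrixP => i j; rewrite !mxE big_ord1.
rewrite (@per_rank1 _ _ _ (fun k => u (lift i k) 0) (fun k => w 0 (lift j k))).
  rewrite mulrnAr mulrACA.
  by rewrite (bigD1_ord i) // [X in _ = (_ * X) *+ _](bigD1_ord j).
by move=> k l; rewrite !mxE big_ord1.
Qed.

(** If [v *m const_mx c = a *: v], each coordinate says [c * sum v = a * v_j].
    Summing over [j] gives [n * c = a] unless [sum v = 0]; in that case
    [a *: v = 0], hence [a = 0]. *)
Lemma eigenvalue_const_mx (F : fieldType) (n : nat) (a c : F) :
  eigenvalue (const_mx c : 'M[F]_n) a -> a = 0 \/ a = c *+ n.
Proof.
move=> /eigenvalueP[v /rowP vM v0]; set S := \sum_j v 0 j.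
have vE j : S * c = a * v 0 j.
  have := vM j; rewrite !mxE => <-; rewrite mulr_suml.
  by apply: eq_bigr => k _; rewrite mxE.
have [S0|S0] := eqVneq S 0.
  left; have /rV0Pn[j vj] := v0.
  by apply: (mulIf vj); rewrite -vE S0 !mul0r.
right; apply: (mulIf S0); rewrite {1}/S mulr_sumr.
under eq_bigr do rewrite -vE.
by rewrite sumr_const card_ord mulrnAl mulrC.
Qed.

Lemma psdmx_diag_ge0 (C : numClosedFieldType) (n : nat) (A : 'M[C]_n) i :
  psdmx A -> 0 <= A i i.
Proof.
move=> [_ /(_ (delta_mx i 0))].
by rewrite trmx_delta map_delta_mx -rowE -colE !mxE.
Qed.

Theorem corollary1 (R : realType) (n : nat) (A : 'M[R[i]]_n) :
  (1 <= n)%N -> psdmx A -> \rank A = 1%N ->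
  (lambda_max (Fmx A))%:C <= per A.
Proof.
move=> n0 psdA /rank1_factor[u [w AE]].
have perE : per A = (\prod_i u i 0 * \prod_j w 0 j) *+ n`!.
  by apply: per_rank1 => i j; rewrite AE mulmx_col_rowE.
have per0 : 0 <= per A.
  rewrite perE -big_split /= mulrn_wge0 // prodr_ge0 // => i _.
  by rewrite -mulmx_col_rowE -AE psdmx_diag_ge0.
have [+ _] := lambda_maxP n0 (Fmx_hermitian psdA.1).
rewrite {1}AE Fmx_rank1 => /eigenvalue_const_mx[-> //|->].
by rewrite -mulrnA mulnC -[in (n * _)%N](prednK n0) -factS (prednK n0) perE.
Qed.
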